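(* Let $E$ and $F$ be Banach lattices. Every sublinear and monotone operator $T:E\rightarrow F$ is Lipschitz continuous and the Lipschitz constant of $T$ equals $\|T\|$, that is, $$\|T(f)-T(g)\|\leq\|T\|\,\|f-g\|\quad\text{for all } f,g\in E.$$
   Context: Operators $T:E\to F$ between Banach lattices are not assumed linear or continuous. $T$ is sublinear if $T(f+g)\leq T(f)+T(g)$ and $T(\alpha f)=\alpha T(f)$ for all $f,g\in E$ and all real $\alpha\geq0$. $T$ is monotone if $f\leq g$ in $E$ implies $T(f)\leq T(g)$. For a continuous sublinear operator $T:E\to F$ the norm is $$\|T\|=\inf\{\lambda>0:\|T(f)\|\leq\lambda\|f\|\text{ for all }f\in E\}=\sup\{\|T(f)\|: f\in E,\ \|f\|\leq1\}.$$ *)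

(* Defs.v *)
From HB Require Import structures.
From mathcomp Require Import all_boot all_order all_algebra.
From mathcomp Require Import all_classical all_reals all_analysis.

Set Implicit Arguments.
Unset Strict Implicit.
Unset Printing Implicit Defensive.

Import Order.TTheory GRing.Theory Num.Theory.
Import numFieldNormedType.Exports.

Local Open Scope classical_set_scope.
Local Open Scope ring_scope.

(* The order is a field of the mixin, not inherited from latticeType: the only
   declared joins of the ordered types with zmodType and with normed modules
   are the number structures, and Hierarchy Builder rejects a more general join
   declared after them. *)
HB.mixin Record isVectorLattice (R : realType) E of GRing.Lmodule R E := {
  vle : rel E;
  vle_refl : reflexive vle;
  vle_anti : antisymmetric vle;
  vle_trans : transitive vle;
  vleD2r : forall h f g : E, vle f g -> vle (f + h) (g + h);
  vscale_ge0 : forall (a : R) (f : E), 0 <= a -> vle 0 f -> vle 0 (a *: f);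
  vsup : E -> E -> E;
  vinf : E -> E -> E;
  vsup_le : forall f g h : E, vle (vsup f g) h = vle f h && vle g h;
  le_vinf : forall f g h : E, vle h (vinf f g) = vle h f && vle h g
}.

#[short(type="vectorLatticeType")]
HB.structure Definition VectorLattice (R : realType) :=
  {E of GRing.Lmodule R E & isVectorLattice R E}.

(* The vector |f| = sup (f, - f), as opposed to the norm `|f| of f. *)
Definition modulus (R : realType) (E : vectorLatticeType R) (f : E) : E :=
  vsup f (- f).

HB.mixin Record isLatticeNormed (R : realType) E
    of NormedModule R E & VectorLattice R E := {
  le_modulus_norm : forall f g : E,
    vle (@modulus R E f) (@modulus R E g) -> `|f| <= `|g| :> R
}.

#[short(type="banachLatticeType")]
HB.structure Definition BanachLattice (R : realType) :=
  {E of CompleteNormedModule R E & VectorLattice R E & isLatticeNormed R E}.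

Definition sublinear (R : realType) (E F : vectorLatticeType R) (T : E -> F) :=
  (forall f g : E, vle (T (f + g)) (T f + T g)) /\
  (forall (a : R) (f : E), 0 <= a -> T (a *: f) = a *: T f).

Definition monotone_op (R : realType) (E F : vectorLatticeType R)
    (T : E -> F) :=
  {homo T : f g / vle f g}.

(* inf set0 = 0, so the next two values are junk unless T is bounded,
   respectively Lipschitz. *)
Definition opnorm (R : realType) (E F : normedModType R) (T : E -> F) : R :=
  inf [set k : R | 0 < k /\ forall f : E, `|T f| <= k * `|f|].

(* The constraint 0 <= k matters only when E is the zero space. *)
Definition lipschitz_constant (R : realType) (E F : normedModType R)
    (T : E -> F) : R :=
  inf [set k : R | 0 <= k /\ k.-lipschitz T].

(* Main.v *)
Require Import Defs.
From mathcomp Require Import all_boot all_order all_algebra.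
From mathcomp Require Import all_classical all_reals all_analysis.
Import Order.TTheory GRing.Theory Num.Theory.
Import numFieldNormedType.Exports.
Local Open Scope classical_set_scope.
Local Open Scope ring_scope.

(** Monotonicity and sublinearity give [T f - T g <= T (f - g) <= T |f - g|],
and the same with [f] and [g] exchanged, hence [|T f - T g| <= T |f - g|]
([modulus_sublinear_sub]). In norm this reads
[‖T f - T g‖ <= ‖T |f - g|‖] ([norm_sublinear_sub]), and as [|f - g|] and
[f - g] have the same norm, every constant bounding [T] is also a Lipschitz
constant. Conversely a Lipschitz constant bounds [T] because [T 0 = 0]. So the
two infima agree, once it is known that they are taken over nonempty sets.

The remaining point is that [T] is bounded, although it is not assumed
continuous ([monotone_sublinear_bounded]). Otherwise there are positive vectors
[u n] of norm [2 ^ - n] with [‖T (u n)‖ >= n]. By completeness the series of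
the [u n] converges; since the order is closed ([vle_lim]) its sum [s]
dominates every [u n], so [0 <= T (u n) <= T s] and [n <= ‖T s‖] for all [n],
which is absurd. *)

(** * Vector lattices *)

Section VectorLattice.
Context {R : realType} {E : vectorLatticeType R}.
Implicit Types f g h : E.

Lemma vle_leB {f g h} : vle f (g + h) -> vle (f - h) g.
Proof. by move=> /(vleD2r (- h)); rewrite addrK. Qed.

Lemma vleD_ge0 {f g h} : vle 0 h -> vle f g -> vle f (g + h).
Proof.
move=> h0 fg; apply: (@vle_trans _ _ (g)) => //.
by have := vleD2r g _ _ h0; rewrite add0r addrC.
Qed.

Lemma modulus_le f h : vle (modulus f) h = vle f h && vle (- f) h.
Proof. exact: vsup_le. Qed.

Lemma le_modulus f : vle f (modulus f).
Proof. by have := vle_refl (modulus f); rewrite modulus_le => /andP[]. Qed.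

Lemma leN_modulus f : vle (- f) (modulus f).
Proof. by have := vle_refl (modulus f); rewrite modulus_le => /andP[]. Qed.

(** Adding [- f <= |f|] to [f <= |f|] gives [0 <= 2 |f|]. *)
Lemma modulus_ge0 f : vle 0 (modulus f).
Proof.
have dbl : vle 0 (modulus f + modulus f).
  apply: (@vle_trans _ _ (modulus f - f)).
    by have := vleD2r (- f) _ _ (le_modulus f); rewrite subrr.
  by have := vleD2r (modulus f) _ _ (leN_modulus f); rewrite addrC.
have half_ge0 : (0 : R) <= 2^-1 by rewrite invr_ge0.
have := vscale_ge0 _ _ half_ge0 dbl.
by rewrite scalerDr -scalerDl -[2^-1]mul1r -splitr scale1r.
Qed.

Lemma ger0_modulus {f} : vle 0 f -> modulus f = f.
Proof.
move=> f0; apply: vle_anti; rewrite le_modulus andbT modulus_le vle_refl /=.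
apply: (@vle_trans _ _ (0)) => //.
by have := vleD2r (- f) _ _ f0; rewrite add0r subrr.
Qed.

Lemma le_series_of_ge0 (u : nat -> E) m n :
  (forall i, vle 0 (u i)) -> (n < m)%N -> vle (u n) (series u m).
Proof.
move=> u0; have s0 k : vle 0 (series u k).
  elim: k => [|k IH]; first by rewrite /series/= big_geq ?vle_refl.
  by rewrite seriesSr; apply: vleD_ge0.
elim: m => // m IH; rewrite ltnS leq_eqVlt seriesSr => /predU1P[->|/IH].
  by rewrite addrC; apply: vleD_ge0 => //; apply: vle_refl.
exact: vleD_ge0.
Qed.

End VectorLattice.

(** * Norm and order in Banach lattices *)

Section BanachLattice.
Context {R : realType} {E : banachLatticeType R}.
Implicit Types f g : E.

Lemma norm_modulus f : `|modulus f| = `|f|.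
Proof.
have idm := ger0_modulus (modulus_ge0 f).
by apply/eqP; rewrite eq_le !le_modulus_norm ?idm ?vle_refl.
Qed.

Lemma norm_le_ge0 {f g} : vle 0 f -> vle f g -> `|f| <= `|g|.
Proof.
move=> f0 fg; apply: le_modulus_norm.
by rewrite !ger0_modulus //; apply: (@vle_trans _ _ (f)).
Qed.

(** The positive part [(g - l)^+] measures how far [g <= l] is from holding.
It is dominated by [|u t - l|] as soon as [g <= u t], so its norm is
arbitrarily small. *)
Lemma vle_lim {I : Type} {A : set_system I} {FA : ProperFilter A}
    (u : I -> E) (g l : E) :
  u @ A --> l -> (\forall t \near A, vle g (u t)) -> vle g l.
Proof.
move=> ul gu; pose p := vsup (g - l) 0.
have := vle_refl p; rewrite vsup_le => /andP[le_p p_ge0].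
suff p0 : p = 0.
  by move: le_p; rewrite p0 => /(vleD2r l); rewrite subrK add0r.
apply/eqP; rewrite -normr_le0; apply/ler_addgt0Pl => e e0; rewrite addr0.
have [t [gut /= ult]] := filter_ex (filterI gu (cvgr_distC_lt _ _ ul _ e0)).
apply: le_trans (ltW ult); rewrite -(norm_modulus (u t - l)).
apply: norm_le_ge0 => //; rewrite vsup_le modulus_ge0 andbT.
exact: vle_trans (vleD2r (- l) _ _ gut) (le_modulus _).
Qed.

End BanachLattice.

(** * Monotone sublinear operators *)

Section MonotoneSublinear.
Context {R : realType} {E F : banachLatticeType R} {T : E -> F}.
Hypotheses (T_sublinear : sublinear T) (T_monotone : monotone_op T).

Lemma sublinear0 : T 0 = 0.
Proof. by have := T_sublinear.2 0 0 (lexx _); rewrite !scale0r. Qed.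

Lemma modulus_sublinear_sub f g :
  vle (modulus (T f - T g)) (T (modulus (f - g))).
Proof.
have sub a b : vle (T a - T b) (T (a - b)).
  by apply: vle_leB; have := T_sublinear.1 (a - b) b; rewrite subrK.
rewrite modulus_le opprB; apply/andP; split; apply: vle_trans (sub _ _) _.
  exact/T_monotone/le_modulus.
by apply: T_monotone; rewrite -opprB; apply: leN_modulus.
Qed.

Lemma norm_sublinear_sub f g : `|T f - T g| <= `|T (modulus (f - g))|.
Proof.
rewrite -(norm_modulus (T f - T g)).
exact: norm_le_ge0 (modulus_ge0 _) (modulus_sublinear_sub f g).
Qed.

Lemma norm_sublinear_modulus f : `|T f| <= `|T (modulus f)|.
Proof. by have := norm_sublinear_sub f 0; rewrite sublinear0 !subr0. Qed.

(** The witness is a rescaling of [|f|], where [f] violates the bound with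
constant [(n + 1) * 2 ^ n]. The factor [2 ^ n] is spent on making the norms
summable, the factor [n + 1] keeps the images unbounded. *)
Lemma unbounded_witness (n : nat) :
  ~ (exists k : R, 0 < k /\ forall f, `|T f| <= k * `|f|) ->
  exists u : E, [/\ vle 0 u, `|u| <= 2^-1 ^+ n & n%:R <= `|T u|].
Proof.
(* The constant must be positive also for n = 0, hence n.+1. *)
pose k : R := n.+1%:R * 2 ^+ n.
move=> /forallNP/(_ k) Nbd.
have k0 : 0 < k by rewrite mulr_gt0 ?ltr0n ?exprn_gt0.
have [f /negP] : exists f, ~ (`|T f| <= k * `|f|).
  by apply/existsNP => bd; apply: Nbd.
rewrite -ltNge => kTf.
have f0 : 0 < `|f|.
  rewrite normr_gt0; apply/eqP => f0.
  by move: kTf; rewrite f0 sublinear0 !normr0 mulr0 ltxx.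
have c0 : 0 <= (2^-1 ^+ n / `|f| : R) by rewrite divr_ge0 ?exprn_ge0 ?invr_ge0.
exists ((2^-1 ^+ n / `|f|) *: modulus f); split.
- exact: vscale_ge0 (modulus_ge0 _).
- by rewrite normrZ ger0_norm // norm_modulus divfK ?gt_eqF.
- rewrite T_sublinear.2 // normrZ ger0_norm //.
  apply: (@le_trans _ _ (2^-1 ^+ n / `|f| * (k * `|f|))); last first.
    apply: ler_wpM2l => //; apply: le_trans (ltW kTf) _.
    exact: norm_sublinear_modulus.
  rewrite mulrACA -mulrA mulVf ?gt_eqF // mulr1 mulrCA -exprMn mulVf //.
  by rewrite expr1n mulr1 ler_nat.
Qed.

(** The sum of a fast converging series of positive vectors dominates each of
them, so by monotonicity [T] is bounded on its terms. *)
Lemma monotone_sublinear_bounded :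
  exists k : R, 0 < k /\ forall f, `|T f| <= k * `|f|.
Proof.
apply: contrapT => Nbd.
have [u uP] := choice (fun n => unbounded_witness n Nbd).
have u0 i : vle 0 (u i) by have [] := uP i.
have cu : cvgn (series u).
  apply: normed_cvg; apply: (@series_le_cvg _ _ (geometric 1 2^-1)) => [n|n|n|].
  - exact: normr_ge0.
  - by rewrite /= mul1r exprn_ge0 ?invr_ge0.
  - by rewrite /= mul1r; have [] := uP n.
  - apply: is_cvg_geometric_series.
    by rewrite ger0_norm ?invr_ge0 // invf_lt1 ?ltr1n.
have Tu_le n : n%:R <= `|T (limn (series u))|.
  have [_ _ nTu] := uP n; apply: le_trans nTu _.
  have u_le : vle (u n) (limn (series u)).
    apply: (vle_lim _ _ _ cu).
    by near=> m; apply: le_series_of_ge0 => //; near: m; exact: nbhs_infty_gt.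
  apply: norm_le_ge0; last exact: T_monotone.
  by rewrite -sublinear0; apply: T_monotone.
have := archi_boundP (normr_ge0 (T (limn (series u)))).
by rewrite ltNge Tu_le.
Unshelve. all: by end_near.
Qed.

Lemma norm_le_opnorm f : `|T f| <= opnorm T * `|f|.
Proof.
have [->|f_neq0] := eqVneq f 0; first by rewrite sublinear0 !normr0 mulr0.
have f0 : 0 < `|f| by rewrite normr_gt0.
rewrite -ler_pdivrMr //; apply: lb_le_inf; first exact: monotone_sublinear_bounded.
by move=> k [_ bd]; rewrite ler_pdivrMr.
Qed.

Lemma opnorm_ge0 : 0 <= opnorm T.
Proof. by apply: lb_le_inf monotone_sublinear_bounded _ => k [/ltW]. Qed.

Lemma sublinear_sub_le_opnorm f g : `|T f - T g| <= opnorm T * `|f - g|.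
Proof.
rewrite -(norm_modulus (f - g)).
exact: le_trans (norm_sublinear_sub f g) (norm_le_opnorm _).
Qed.

Lemma klipschitz_opnorm : (opnorm T).-lipschitz T.
Proof. by move=> [f g] _; apply: sublinear_sub_le_opnorm. Qed.

Lemma opnorm_le_klipschitz (k : R) : 0 <= k -> k.-lipschitz T -> opnorm T <= k.
Proof.
move=> k0 lip; apply/ler_addgt0Pr => e e0; apply: ge_inf.
  by exists 0 => c [/ltW].
split=> [|f]; first exact: ltr_wpDl.
have := lip (f, 0) (conj I I); rewrite /= sublinear0 !subr0 => /le_trans; apply.
by rewrite ler_wpM2r // lerDl ltW.
Qed.

End MonotoneSublinear.

Theorem theorem1 (R : realType) (E F : banachLatticeType R) (T : E -> F)
  (T_sublinear : sublinear T) (T_monotone : monotone_op T) :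
  [/\ lipschitz T,
      lipschitz_constant T = opnorm T
    & forall f g : E, `|T f - T g| <= opnorm T * `|f - g|].
Proof.
have lipT := klipschitz_opnorm T_sublinear T_monotone.
split; [| |exact: sublinear_sub_le_opnorm].
  have PF : ProperFilter (globally ([set: E] `*` [set: E])).
    exact: (@globally_properfilter _ _ (0, 0)).
  exact: klipschitzW lipT.
apply/eqP; rewrite eq_le; apply/andP; split.
  apply: ge_inf; first by exists 0 => k [].
  by split=> //; apply: opnorm_ge0.
apply: lb_le_inf => [|k [k0 lip]]; first exists (opnorm T).
  by split=> //; apply: opnorm_ge0.
exact: opnorm_le_klipschitz.
Qed.
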